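(* The Loy--Willis ideal $\mathscr{M}$ of $\mathscr{B}(C_0[0,\omega_1))$ contains a net $(Q_D)_{D\in\Gamma}$ of projections, each having norm at most two, such that, for each operator $T\in\mathscr{M}$, there is $D_0\in\Gamma$ for which $Q_DT=T$ whenever $D\ge D_0$. Hence $(Q_D)_{D\in\Gamma}$ is a bounded left approximate identity in $\mathscr{M}$.
   Context: Scalars are in $\mathbb{K}=\mathbb{R}$ or $\mathbb{K}=\mathbb{C}$. $\omega_1$ is the first uncountable ordinal; ordinal intervals carry the order topology. $C_0[0,\omega_1)$ is the Banach space (supremum norm) of continuous functions $[0,\omega_1)\to\mathbb{K}$ that vanish eventually, and $\mathscr{B}(X)$ is the Banach algebra of bounded operators on $X$. Loy--Willis ideal: every functional in $C[0,\omega_1]^*$ has a unique representation $\sum_{\gamma\le\omega_1}g(\gamma)\delta_\gamma$ with $\sum_{\gamma\le\omega_1}|g(\gamma)|<\infty$, where $\delta_\gamma$ is the point evaluation at $\gamma$. The matrix of $T\in\mathscr{B}(C[0,\omega_1])$ is defined by $T^*\delta_\beta=\sum_{\gamma\le\omega_1}T_{\beta,\gamma}\delta_\gamma$. The original Loy--Willis ideal of $\mathscr{B}(C[0,\omega_1])$ is the set of $T$ such that the function $\beta\mapsto T_{\beta,\omega_1}$ on $[0,\omega_1]$ is continuous at $\omega_1$; it is a two-sided ideal of codimension one. The Loy--Willis ideal $\mathscr{M}$ of $\mathscr{B}(C_0[0,\omega_1))$ consists of those $T$ for which $U^{-1}TU$ belongs to the original Loy--Willis ideal, where $U$ is an isomorphism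 of $C[0,\omega_1]$ onto $C_0[0,\omega_1)$ (the definition is independent of the choice of $U$). A net $(e_\gamma)_{\gamma\in\Gamma}$ in a Banach algebra $\mathscr{A}$ is a bounded left approximate identity if $\sup_{\gamma\in\Gamma}\|e_\gamma\|<\infty$ and the net $(e_\gamma a)_{\gamma\in\Gamma}$ converges to $a$ for each $a\in\mathscr{A}$. A projection is a bounded idempotent operator. *)

(* Defs.v *)
From HB Require Import structures.
From mathcomp Require Import all_boot all_order all_algebra finmap.
From mathcomp Require Import complex.
From mathcomp Require Import all_classical all_reals all_analysis.
From mathcomp Require wochoice summability.

Set Implicit Arguments.
Unset Strict Implicit.
Unset Printing Implicit Defensive.
Import Order.TTheory GRing.Theory Num.Theory.
Import numFieldNormedType.Exports.
Local Open Scope classical_set_scope.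
Local Open Scope ring_scope.

Definition well_founded_order d (T : porderType d) :=
  forall A : set T, A !=set0 -> exists2 m, A m & forall x, A x -> (m <= x)%O.

Fact omega1_display : Order.disp_t. Proof. exact: (Order.Disp tt tt). Qed.

Definition set_nat_le : rel (set nat) :=
  sval (wochoice.well_ordering_principle (set nat)).

Lemma set_nat_le_wo : wochoice.well_order set_nat_le.
Proof. exact: (svalP (wochoice.well_ordering_principle (set nat))). Qed.

(* [0, omega_1), realised inside a well-ordering of the uncountable set of all
   subsets of nat, as its elements with only countably many predecessors *)
Record omega1_carrier := Omega1Carrier {
  omega1_val : set nat;
  _ : `[< countable [set y | set_nat_le y omega1_val] >] }.

HB.instance Definition _ := [isSub for omega1_val].
HB.instance Definition _ := [Choice of omega1_carrier by <:].

Section omega1_order.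
Local Notation le_R := set_nat_le.
Local Notation le_R_wo := set_nat_le_wo.

Definition omega1_le (x y : omega1_carrier) : bool := le_R (omega1_val x) (omega1_val y).
Definition omega1_lt (x y : omega1_carrier) : bool := (y != x) && omega1_le x y.

Lemma set_nat_le_chain : wochoice.wo_chain le_R predT.
Proof. by move=> C _; exact: le_R_wo. Qed.

Lemma set_nat_le_anti x y : le_R x y -> le_R y x -> x = y.
Proof.
by move=> xy yx; apply: (wochoice.wo_chain_antisymmetric set_nat_le_chain); rewrite ?inE ?xy.
Qed.

Let le_R_trans : transitive le_R.
Proof.
move=> y x z xy yz.
pose A : {pred set nat} := pred3 x y z.
have [m [[mA lm] _]] := @le_R_wo A (ex_intro (fun u => u \in A) x (predU1l _ erefl)).
have mx : le_R m x by apply: lm; rewrite inE eqxx.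
have my : le_R m y by apply: lm; rewrite inE eqxx orbT.
have mz : le_R m z by apply: lm; rewrite inE eqxx !orbT.
case/or3P: mA => /eqP E; rewrite {}E in mx my mz => //.
- by rewrite (set_nat_le_anti xy mx).
- by rewrite -(set_nat_le_anti yz my).
Qed.

Fact omega1_le_anti : antisymmetric omega1_le.
Proof. by move=> x y /andP[xy yx]; apply/val_inj/set_nat_le_anti. Qed.

Fact omega1_le_total : total omega1_le.
Proof. by move=> x y; apply: (wochoice.wo_chainW set_nat_le_chain). Qed.

Fact omega1_le_trans : transitive omega1_le.
Proof. by move=> y x z; apply: le_R_trans. Qed.

HB.instance Definition _ := @Order.isOrder.Build omega1_display omega1_carrier
  omega1_le omega1_lt _ _ (fun _ _ => erefl) (fun _ _ => erefl)
  (fun _ _ => erefl) omega1_le_anti omega1_le_trans omega1_le_total.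

End omega1_order.

Definition omega1 : Type := omega1_carrier.
HB.instance Definition _ :=
  OrderTopological.copy omega1 (order_topology omega1_carrier).

Section omega1_theory.
Local Notation le_R := set_nat_le.
Local Notation le_R_wo := set_nat_le_wo.

Lemma omega1_well_founded : well_founded_order omega1.
Proof.
move=> A [a Aa].
pose B : {pred set nat} := [pred u | `[< exists2 x : omega1, A x & omega1_val x = u >]].
have Ba : omega1_val a \in B by apply/asboolP; exists a.
have [m [[/asboolP[x Ax xm] lm] _]] := le_R_wo (ex_intro (fun u => u \in B) _ Ba).
exists x => // y Ay; change (le_R (omega1_val x) (omega1_val y)).
by rewrite xm; apply: lm; apply/asboolP; exists y.
Qed.

Lemma omega1_countable_initial (x : omega1) : countable [set y | (y <= x)%O].
Proof.
have /asboolP/countable_injP[f finj] := valP (x : omega1_carrier).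
apply/countable_injP; exists (fun y : omega1 => f (omega1_val y)).
move=> y z /[!inE] yx zx /finj yz; apply: val_inj; apply: yz; rewrite inE.
- exact: yx.
- exact: zx.
Qed.

Let set_nat_uncountable : ~ countable [set: set nat].
Proof.
move=> /countable_injP[f finj].
pose D : set nat := [set n | exists2 S : set nat, f S = n & ~ S n].
have nDD : ~ D (f D).
  by move=> DD; case: (DD) => S /finj SD; rewrite SD ?inE.
by apply: (nDD); exists D.
Qed.

Lemma omega1_uncountable : ~ countable [set: omega1].
Proof.
move=> cW.
pose P : set (set nat) := [set u | countable [set y | le_R y u]].
have cP : countable P.
  move/countable_injP : cW => [f finj].
  pose g (u : set nat) : nat :=
    if pselect (P u) is left Pu then f (Omega1Carrier (asboolT Pu)) else 0%N.
  apply/countable_injP; exists g => u v /[!inE] Pu Pv; rewrite /g.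
  case: pselect => // {}Pu; case: pselect => // {}Pv.
  by move=> /finj /[!inE] /(_ I I) [].
pose B : {pred set nat} := [pred u | `[< ~ P u >]].
have [[u Bu]|nB] := pselect (exists u, u \in B); last first.
  apply: set_nat_uncountable; apply: sub_countable cP; apply: subset_card_le => u _.
  by apply: contrapT => nPu; apply: nB; exists u; apply/asboolP.
have [m [[/asboolP nPm lm] _]] := le_R_wo (ex_intro (fun u => u \in B) u Bu).
apply: nPm; rewrite /P/=.
have : countable (P `|` [set m]).
  rewrite -bigcup2E; apply: bigcup_countable => // i _.
  by case: i => [|[|i]] //=.
apply: sub_countable; apply: subset_card_le => y /= ym.
have [Py|nPy] := pselect (P y); first by left.
by right; apply: set_nat_le_anti => //; apply: lm; apply/asboolP.
Qed.

End omega1_theory.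

Definition with_top (T : Type) : Type := option T.

Section with_top.
Context {d : Order.disp_t} {T : orderType d}.
Local Notation oT := (with_top T).
HB.instance Definition _ := Choice.on oT.

Definition with_top_le (x y : oT) : bool :=
  match x, y with
  | _, None => true
  | None, Some _ => false
  | Some a, Some b => (a <= b)%O
  end.

Definition with_top_lt (x y : oT) : bool := (y != x) && with_top_le x y.

Fact with_top_le_anti : antisymmetric with_top_le.
Proof. by move=> [x|] [y|] //= /le_anti ->. Qed.

Fact with_top_le_trans : transitive with_top_le.
Proof. by move=> [y|] [x|] [z|] //=; exact: le_trans. Qed.

Fact with_top_le_total : total with_top_le.
Proof. by move=> [x|] [y|] //=; exact: le_total. Qed.

HB.instance Definition _ := @Order.isOrder.Build d oT
  with_top_le with_top_lt _ _ (fun _ _ => erefl) (fun _ _ => erefl)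
  (fun _ _ => erefl) with_top_le_anti with_top_le_trans with_top_le_total.

Lemma with_top_well_founded : well_founded_order T -> well_founded_order oT.
Proof.
move=> wf A [a Aa].
have [[b Ab]|nA] := pselect (exists b : T, A (Some b)).
  have [m Am lm] := wf (fun b => A (Some b)) (ex_intro _ b Ab).
  by exists (Some m) => // -[x|] Ax //; exact: lm.
exists a => // -[x|] Ax; first by exfalso; apply: nA; exists x.
by case: (a).
Qed.

End with_top.

(* [0, omega_1], with None as the point omega_1 *)
Definition omega1S : Type := with_top omega1.
HB.instance Definition _ :=
  OrderTopological.copy omega1S (order_topology (with_top omega1)).

Definition omega1_pt : omega1S := @None omega1.

Lemma omega1S_well_founded : well_founded_order omega1S.
Proof. exact: (with_top_well_founded omega1_well_founded). Qed.

Lemma continuous_bounded_initial d (X : orderTopologicalType d)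
    (K : numFieldType) (f : X -> K) (x : X) :
  well_founded_order X -> continuous f ->
  exists M, forall y, (y <= x)%O -> `|f y| <= M.
Proof.
move=> wf cf; apply: contrapT => nx.
pose P z := exists M, forall y, (y <= z)%O -> `|f y| <= M.
have [m nPm lm] := wf (fun z => ~ P z) (ex_intro _ x nx).
have Plt z : (z < m)%O -> P z.
  by move=> zm; apply: contrapT => /lm; rewrite leNgt zm.
apply: nPm.
have : nbhs m [set y | `|f y| <= `|f m| + 1].
  have /cvgrPdist_le /(_ 1 ltr01) := cf m.
  apply: filterS => y /= fmy.
  rewrite -[f y](subrK (f m)) addrC (le_trans (ler_normD _ _))// lerD2l.
  by rewrite distrC.
rewrite itv_nbhsE => -[[l r] [/= oi mi] sub].
have fm0 : 0 <= `|f m| + 1 by rewrite addr_ge0.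
case: l oi mi sub => [[] a|[]] /= oi mi sub.
- by case: r oi {mi sub} => [[]|[]].
- move: mi; rewrite itv_boundlr bnd_simp /= => /andP[am mr].
  have [M aM] := Plt _ am.
  have M0 : 0 <= M by apply: le_trans (aM a _).
  exists (M + (`|f m| + 1)) => y ym.
  have [ya|ay] := leP y a; first by rewrite (le_trans (aM _ ya))// lerDl.
  apply: (@le_trans _ _ (`|f m| + 1)); last by rewrite lerDr.
  apply: sub; rewrite /= itv_boundlr bnd_simp ay/=.
  by apply: le_trans mr; rewrite bnd_simp.
- exists (`|f m| + 1) => y ym; apply: sub; move: mi.
  rewrite /= !itv_boundlr /= => mr.
  by apply: le_trans mr; rewrite bnd_simp.
- by case: r oi mi {sub} => [[]|[]] //=.
Qed.

Inductive scalars := RealScalars | ComplexScalars.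

Definition scalar_field (R : realType) (s : scalars) : numFieldType :=
  match s with
  | RealScalars => R
  | ComplexScalars => R[i]%C
  end.

Section suprema.
Variables (R : realType) (s : scalars).
Local Notation K := (scalar_field R s).
Implicit Type A : set K.

Lemma scalar_supremums A M : A !=set0 -> (forall x, A x -> 0 <= x <= M) ->
  supremums A (supremum 0 A).
Proof.
move=> A0 AM; rewrite /supremum ifF; last by apply/negbTE/set0P.
case: xgetP => // noS; exfalso; move: A A0 M AM noS.
case: s => /= A A0 M AM; last first.
  pose B : set R := [set complex.Re x | x in A].
  have hB : has_sup B.
    split; first by case: A0 => a Aa; exists (complex.Re a), a.
    by exists (complex.Re M) => _ [x /AM /andP[_ + <-]]; rewrite lecE => /andP[].
  move=> /(_ (sup B)%:C%C); apply; split.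
  - move=> x Ax; rewrite lecE /=; have /andP[+ _] := AM _ Ax.
    rewrite lecE /= => /andP[/eqP -> _]; rewrite eqxx /=.
    by apply: ub_le_sup; [case: hB|exists x].
  - move=> y uy; case: A0 => a Aa; have := uy _ Aa; have /andP[+ _] := AM _ Aa.
    rewrite !lecE /= => /andP[/eqP ima _] /andP[/eqP yi _].
    rewrite yi ima eqxx /=; apply: ge_sup; first by exists (complex.Re a), a.
    by move=> _ [x /uy + <-]; rewrite lecE => /andP[].
move=> /(_ (sup A)); apply.
have hA : has_sup A by split => //; exists M => x /AM /andP[].
split; first by move=> x Ax; apply: ub_le_sup => //; case: hA.
by move=> y uy; apply: ge_sup.
Qed.

End suprema.

Section supnorm.
Variables (R : realType) (s : scalars).
Local Notation K := (scalar_field R s).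
Variables (I : Type) (D : set I) (V : normedModType K).
Implicit Types f g : I -> V.

Definition bounded_fun_on f := exists M, forall x, D x -> `|f x| <= M.

Definition supnorm f : K := supremum 0 [set `|f x| | x in D].

Lemma supnorm_ub f x : bounded_fun_on f -> D x -> `|f x| <= supnorm f.
Proof.
move=> [M fM] Dx.
have [|_ [y /fM + <-]|+ _] := @scalar_supremums R s [set `|f x| | x in D] M.
- by exists `|f x|, x.
- by rewrite normr_ge0.
- by apply; exists x.
Qed.

Lemma supnorm_le f M : 0 <= M -> (forall x, D x -> `|f x| <= M) ->
  supnorm f <= M.
Proof.
move=> M0 fM; rewrite /supnorm.
have [->|/set0P A0] := eqVneq [set `|f x| | x in D] set0.
  by rewrite supremum0.
have [|_ + ] := @scalar_supremums R s _ M A0.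
  by move=> _ [y /fM + <-]; rewrite normr_ge0.
by apply => _ [y /fM + <-].
Qed.

Lemma supnorm_ge0 f : bounded_fun_on f -> 0 <= supnorm f.
Proof.
move=> bf; have [[x Dx]|nD] := pselect (D !=set0).
  by rewrite (le_trans _ (supnorm_ub bf Dx)).
rewrite /supnorm; have -> : [set `|f x| | x in D] = set0.
  by rewrite -subset0 => y [x Dx yE]; apply: nD; exists x.
by rewrite supremum0.
Qed.

Lemma supnormD f g : bounded_fun_on f -> bounded_fun_on g ->
  supnorm (f + g) <= supnorm f + supnorm g.
Proof.
move=> bf bg; apply: supnorm_le => [|x Dx].
  by rewrite addr_ge0 ?supnorm_ge0.
by rewrite (le_trans (ler_normD _ _))// lerD ?supnorm_ub.
Qed.

Let supnormZ_le f a : bounded_fun_on f -> supnorm (a *: f) <= `|a| * supnorm f.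
Proof.
move=> bf; apply: supnorm_le => [|x Dx]; first by rewrite mulr_ge0 ?supnorm_ge0.
by rewrite normrZ ler_wpM2l ?supnorm_ub.
Qed.

Lemma bounded_fun_onD f g : bounded_fun_on f -> bounded_fun_on g ->
  bounded_fun_on (f + g).
Proof.
move=> [M fM] [N gN]; exists (M + N) => x Dx.
by rewrite (le_trans (ler_normD _ _))// lerD ?fM ?gN.
Qed.

Lemma bounded_fun_onZ a f : bounded_fun_on f -> bounded_fun_on (a *: f).
Proof.
by move=> [M fM]; exists (`|a| * M) => x Dx; rewrite normrZ ler_wpM2l ?fM.
Qed.

Lemma supnormZ a f : bounded_fun_on f -> supnorm (a *: f) = `|a| * supnorm f.
Proof.
move=> bf; apply/eqP; rewrite eq_le supnormZ_le//=.
have [->|a0] := eqVneq a 0.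
  by rewrite normr0 mul0r supnorm_ge0//; exact: bounded_fun_onZ.
rewrite mulrC -ler_pdivlMr ?normr_gt0// mulrC -normfV.
rewrite -[in leLHS](scale1r f) -(mulVf a0) -scalerA supnormZ_le//.
exact: bounded_fun_onZ.
Qed.

Lemma supnorm_eq0 f : bounded_fun_on f -> supnorm f = 0 ->
  forall x, D x -> f x = 0.
Proof.
move=> bf f0 x Dx; apply/eqP; rewrite -normr_le0 -f0; exact: supnorm_ub.
Qed.

End supnorm.

Lemma continuous_fun0 (X : topologicalType) (K : numFieldType) :
  continuous (0 : X -> K).
Proof. by move=> x; exact: cst_continuous. Qed.

Lemma continuous_fun_linear (X : topologicalType) (K : numFieldType) (a : K)
  (f g : X -> K) : continuous f -> continuous g -> continuous (a *: f + g).
Proof. by move=> cf cg x; apply: cvgD; [apply: cvgZl_tmp; exact: cf|exact: cg]. Qed.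

Section C_omega1S.
Variables (R : realType) (s : scalars).
Local Notation K := (scalar_field R s).

Definition C_omega1S_pred : {pred omega1S -> K} := [pred f | `[< continuous f >]].

Fact C_omega1S_submod_closed : submod_closed C_omega1S_pred.
Proof.
split; first by apply/asboolP; exact: continuous_fun0.
move=> a f g /asboolP cf /asboolP cg; apply/asboolP.
exact: continuous_fun_linear.
Qed.
HB.instance Definition _ :=
  GRing.isSubmodClosed.Build _ _ C_omega1S_pred C_omega1S_submod_closed.

(* C[0, omega_1] *)
Record C_omega1S := COmega1S {
  C_omega1S_fun :> omega1S -> K;
  _ : C_omega1S_fun \in C_omega1S_pred }.

HB.instance Definition _ := [isSub for C_omega1S_fun].
HB.instance Definition _ := [Choice of C_omega1S by <:].
HB.instance Definition _ := [SubChoice_isSubLmodule of C_omega1S by <:].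

Lemma C_omega1S_continuous (f : C_omega1S) : continuous f.
Proof. by apply/asboolP; exact: (valP f). Qed.

Lemma C_omega1S_bounded (f : C_omega1S) : bounded_fun_on setT f.
Proof.
have [M fM] := continuous_bounded_initial omega1_pt omega1S_well_founded
  (@C_omega1S_continuous f).
by exists M => x _; apply: fM; case: x.
Qed.

Let nrm (f : C_omega1S) : K := supnorm setT f.

Let nrmD f g : nrm (f + g) <= nrm f + nrm g.
Proof. by apply: supnormD; exact: C_omega1S_bounded. Qed.

Let nrmZ a f : nrm (a *: f) = `|a| * nrm f.
Proof. by apply: supnormZ; exact: C_omega1S_bounded. Qed.

Let nrm_eq0 f : nrm f = 0 -> f = 0.
Proof.
move=> f0; apply/val_inj/funext => x.
exact: (supnorm_eq0 (@C_omega1S_bounded f) f0).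
Qed.

HB.instance Definition _ := Lmodule_isNormed.Build K C_omega1S nrmD nrmZ nrm_eq0.

Lemma C_omega1S_normE (f : C_omega1S) :
  `|f| = supremum 0 [set `|f x| | x in [set: omega1S]].
Proof. by []. Qed.

End C_omega1S.

Section C0_omega1.
Variables (R : realType) (s : scalars).
Local Notation K := (scalar_field R s).

Definition C0_omega1_pred : {pred omega1 -> K} :=
  [pred f | `[< continuous f /\
    exists a : omega1, forall b, (a <= b)%O -> f b = 0 >]].

Fact C0_omega1_submod_closed : submod_closed C0_omega1_pred.
Proof.
have [x0] : inhabited omega1.
  apply: contrapT => nX; apply: omega1_uncountable.
  rewrite (_ : setT = set0)//; apply/seteqP; split => // x _.
  by exfalso; apply: nX.
split; first by apply/asboolP; split; [exact: continuous_fun0|exists x0].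
move=> k f g /asboolP[cf [a fa]] /asboolP[cg [b gb]]; apply/asboolP; split.
  exact: continuous_fun_linear.
exists (Order.max a b) => c; rewrite ge_max => /andP[ac bc].
change (k * f c + g c = 0).
by rewrite fa// gb// mulr0 addr0.
Qed.
HB.instance Definition _ :=
  GRing.isSubmodClosed.Build _ _ C0_omega1_pred C0_omega1_submod_closed.

(* C_0[0, omega_1) *)
Record C0_omega1 := C0Omega1 {
  C0_omega1_fun :> omega1 -> K;
  _ : C0_omega1_fun \in C0_omega1_pred }.

HB.instance Definition _ := [isSub for C0_omega1_fun].
HB.instance Definition _ := [Choice of C0_omega1 by <:].
HB.instance Definition _ := [SubChoice_isSubLmodule of C0_omega1 by <:].

Lemma C0_omega1_continuous (f : C0_omega1) : continuous f.
Proof. by have /asboolP[] := valP f. Qed.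

Lemma C0_omega1_vanish (f : C0_omega1) :
  exists a : omega1, forall b, (a <= b)%O -> f b = 0.
Proof. by have /asboolP[] := valP f. Qed.

Lemma C0_omega1_bounded (f : C0_omega1) : bounded_fun_on setT f.
Proof.
have [a fa] := C0_omega1_vanish f.
have [M fM] := continuous_bounded_initial a omega1_well_founded
  (@C0_omega1_continuous f).
have M0 : 0 <= M by rewrite (le_trans _ (fM a _)).
exists M => x _; have [xa|/ltW/fa ->] := leP x a; first exact: fM.
by rewrite normr0.
Qed.

Let nrm (f : C0_omega1) : K := supnorm setT f.

Let nrmD f g : nrm (f + g) <= nrm f + nrm g.
Proof. by apply: supnormD; exact: C0_omega1_bounded. Qed.

Let nrmZ a f : nrm (a *: f) = `|a| * nrm f.
Proof. by apply: supnormZ; exact: C0_omega1_bounded. Qed.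

Let nrm_eq0 f : nrm f = 0 -> f = 0.
Proof.
move=> f0; apply/val_inj/funext => x.
exact: (supnorm_eq0 (@C0_omega1_bounded f) f0).
Qed.

HB.instance Definition _ := Lmodule_isNormed.Build K C0_omega1 nrmD nrmZ nrm_eq0.

Lemma C0_omega1_normE (f : C0_omega1) :
  `|f| = supremum 0 [set `|f x| | x in [set: omega1]].
Proof. by []. Qed.

End C0_omega1.

Section bounded_operators.
Variables (R : realType) (s : scalars).
Local Notation K := (scalar_field R s).
Variables X Y : normedModType K.

Definition bounded_operator_pred : {pred X -> Y} :=
  [pred T | `[< linear T /\ exists M, forall x, `|T x| <= M * `|x| >]].

Fact bounded_operator_submod_closed : submod_closed bounded_operator_pred.
Proof.
split.
  apply/asboolP; split; first by move=> a x y; rewrite scaler0 addr0.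
  by exists 0 => x; rewrite normr0 mul0r.
move=> k S T /asboolP[lS [M SM]] /asboolP[lT [N TN]]; apply/asboolP; split.
  move=> a x y; change (k *: S (a *: x + y) + T (a *: x + y) =
    a *: (k *: S x + T x) + (k *: S y + T y)).
  by rewrite lS lT !scalerDr !scalerA (mulrC k) addrACA.
exists (`|k| * M + N) => x; rewrite (le_trans (ler_normD _ _))// mulrDl lerD//.
by rewrite normrZ -mulrA ler_wpM2l.
Qed.
HB.instance Definition _ := GRing.isSubmodClosed.Build _ _
  bounded_operator_pred bounded_operator_submod_closed.

Record bounded_operator := BoundedOperator {
  bounded_operator_fun :> X -> Y;
  _ : bounded_operator_fun \in bounded_operator_pred }.

HB.instance Definition _ := [isSub for bounded_operator_fun].
HB.instance Definition _ := [Choice of bounded_operator by <:].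
HB.instance Definition _ := [SubChoice_isSubLmodule of bounded_operator by <:].

Lemma bounded_operator_linear (T : bounded_operator) : linear T.
Proof. by have /asboolP[] := valP T. Qed.

Lemma bounded_operator_bound (T : bounded_operator) :
  exists M, forall x, `|T x| <= M * `|x|.
Proof. by have /asboolP[] := valP T. Qed.

HB.instance Definition _ (T : bounded_operator) :=
  GRing.isLinear.Build K X Y *:%R T (bounded_operator_linear T).

Local Notation unit_ball := [set x : X | `|x| <= 1].

Lemma bounded_operator_bounded (T : bounded_operator) :
  bounded_fun_on unit_ball T.
Proof.
have [M TM] := bounded_operator_bound T; exists `|M| => x /= x1.
have [->|x0] := eqVneq x 0; first by rewrite linear0 normr0.
have M0 : 0 <= M.
  by rewrite -(pmulr_lge0 _ (_ : 0 < `|x|)) ?normr_gt0// (le_trans _ (TM x)).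
by rewrite (le_trans (TM x))// ger0_norm// -[leRHS]mulr1 ler_wpM2l.
Qed.

Let opnorm (T : bounded_operator) : K := supnorm unit_ball T.

Let opnormD S T : opnorm (S + T) <= opnorm S + opnorm T.
Proof. by apply: supnormD; exact: bounded_operator_bounded. Qed.

Let opnormZ a T : opnorm (a *: T) = `|a| * opnorm T.
Proof. by apply: supnormZ; exact: bounded_operator_bounded. Qed.

Let opnorm_ge (T : bounded_operator) x : `|T x| <= opnorm T * `|x|.
Proof.
have [->|x0] := eqVneq x 0; first by rewrite linear0 !normr0 mulr0.
have nx : `|x|^-1 = `|(`|x|^-1 : K)| by rewrite ger0_norm// invr_ge0.
rewrite -ler_pdivrMr ?normr_gt0// mulrC nx -normrZ -linearZ.
apply: supnorm_ub; first exact: bounded_operator_bounded.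
by rewrite /= normrZ -nx mulVf// normr_eq0.
Qed.

Let opnorm_eq0 T : opnorm T = 0 -> T = 0.
Proof.
move=> T0; apply/val_inj/funext => x; apply/eqP.
by rewrite -normr_le0 (le_trans (opnorm_ge T x))// T0 mul0r.
Qed.

HB.instance Definition _ :=
  Lmodule_isNormed.Build K bounded_operator opnormD opnormZ opnorm_eq0.

Lemma bounded_operator_normE (T : bounded_operator) :
  `|T| = supremum 0 [set `|T x| | x in [set x : X | `|x| <= 1]].
Proof. by []. Qed.

Lemma bounded_operator_norm_ge (T : bounded_operator) x : `|T x| <= `|T| * `|x|.
Proof. exact: opnorm_ge. Qed.

End bounded_operators.

Section composition.
Variables (R : realType) (s : scalars).
Local Notation K := (scalar_field R s).

Fact comp_operator_subproof (X Y Z : normedModType K)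
    (S : bounded_operator Y Z) (T : bounded_operator X Y) :
  (S \o T : X -> Z) \in bounded_operator_pred (X := X) (Y := Z).
Proof.
apply/asboolP; split; first by move=> a x y; rewrite /= !linearP.
exists (`|S| * `|T|) => x /=; rewrite (le_trans (bounded_operator_norm_ge _ _))//.
by rewrite -mulrA ler_wpM2l// bounded_operator_norm_ge.
Qed.

Definition comp_operator (X Y Z : normedModType K)
    (S : bounded_operator Y Z) (T : bounded_operator X Y) :
  bounded_operator X Z := BoundedOperator (comp_operator_subproof S T).

End composition.

Notation "S \oB T" := (comp_operator S T)
  (at level 40, left associativity) : ring_scope.

Definition operator_inverse (R : realType) (s : scalars)
    (X Y : normedModType (scalar_field R s))
    (U : bounded_operator X Y) (V : bounded_operator Y X) : Prop :=
  cancel U V /\ cancel V U.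

Definition projection (R : realType) (s : scalars)
    (X : normedModType (scalar_field R s)) (P : bounded_operator X X) : Prop :=
  P \oB P = P.

Section Loy_Willis.
Variables (R : realType) (s : scalars).
Local Notation K := (scalar_field R s).
Local Notation C := (C_omega1S R s).
Local Notation C0 := (C0_omega1 R s).

Fact point_evaluation_subproof (gamma : omega1S) :
  (fun f : C => f gamma : K) \in bounded_operator_pred (X := C) (Y := K).
Proof.
apply/asboolP; split => //.
exists 1 => f; rewrite mul1r.
exact: (supnorm_ub (@C_omega1S_bounded R s f)).
Qed.

Definition point_evaluation (gamma : omega1S) : bounded_operator C K :=
  BoundedOperator (point_evaluation_subproof gamma).

(* g is absolutely summable and phi is the unordered sum of the
   g(gamma) delta_gamma, gamma <= omega_1, in the dual of C[0, omega_1] *)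
Definition functional_coefficients (phi : bounded_operator C K)
    (g : omega1S -> K) : Prop :=
  (exists M : K, forall A : {fset omega1S},
     summability.partial_sum (fun gamma => `|g gamma|) A <= M) /\
  summability.partial_sum (fun gamma => g gamma *: point_evaluation gamma) A
    @[A --> summability.totally] --> phi.

(* point_evaluation beta \oB T is T^* delta_beta *)
Definition operator_matrix (T : bounded_operator C C)
    (m : omega1S -> omega1S -> K) : Prop :=
  forall beta, functional_coefficients (point_evaluation beta \oB T) (m beta).

(* a bounded operator on C[0, omega_1] has exactly one matrix *)
Definition original_Loy_Willis_ideal : set (bounded_operator C C) :=
  [set T | exists2 m, operator_matrix T m &
    {for omega1_pt, continuous (fun beta => m beta omega1_pt)}].

(* V is U^-1; the condition does not depend on the choice of U *)
Definition Loy_Willis_ideal : set (bounded_operator C0 C0) :=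
  [set T | exists (U : bounded_operator C C0) (V : bounded_operator C0 C),
    operator_inverse U V /\ original_Loy_Willis_ideal (V \oB T \oB U)].

End Loy_Willis.

Definition directed (I : Type) (le : I -> I -> Prop) : Prop :=
  [/\ inhabited I, (forall i, le i i),
      (forall i j k, le i j -> le j k -> le i k) &
      forall i j, exists2 k, le i k & le j k].

Definition net_filter (I : Type) (le : I -> I -> Prop) : set_system I :=
  filter_from [set: I] (fun i => [set j | le i j]).

Definition bounded_left_approximate_identity (R : realType) (s : scalars)
    (X : normedModType (scalar_field R s)) (A : set (bounded_operator X X))
    (I : Type) (le : I -> I -> Prop) (e : I -> bounded_operator X X) : Prop :=
  [/\ directed le,
      (forall i, A (e i)),
      (exists M, forall i, `|e i| <= M) &
      forall T, A T -> e i \oB T @[i --> net_filter le] --> T].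

(* Main.v *)
(* Let D be a club in omega_1 and write d(x) for the least element of D that is
   at least x.  The projection Q_D f = f - f o d has the functions vanishing on D as its range,
   so Q_D T = T as soon as every T f vanishes on D.  Clubs, ordered by reverse
   inclusion, are directed, and it remains to find such a club for T in M.

   A family of bounded functionals psi_x on C_0[0, omega_1), x < omega_1, that is
   weak* continuous in x and eventually zero on each f satisfies psi_x = a(x) delta_x
   for x in a club.  This applies to T^* delta_x and, when V = U^-1 is an isomorphism
   onto C[0, omega_1], to V^* (delta_x - delta_omega_1).  For S = V T U it gives
   S^* delta_x = S^* delta_omega_1 + a(x) (delta_x - delta_omega_1) on a club, so
   the entries of S at (x, omega_1) and (omega_1, omega_1) differ by a(x);
   continuity at omega_1 forces a(x) = 0 for large x. *)

Require Import Defs.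
From mathcomp Require Import all_boot all_order all_algebra finmap.
From mathcomp Require Import complex.
From mathcomp Require Import all_classical all_reals all_analysis.
From mathcomp Require summability.

Set Implicit Arguments.
Unset Strict Implicit.
Unset Printing Implicit Defensive.
Import Order.TTheory GRing.Theory Num.Theory.
Import numFieldNormedType.Exports.
Local Open Scope classical_set_scope.
Local Open Scope ring_scope.

(** * Topology and clubs of [omega_1] *)

Lemma omega1_ind (P : omega1 -> Prop) :
  (forall x, (forall y, (y < x)%O -> P y) -> P x) -> forall x, P x.
Proof.
move=> H x; apply: contrapT => nPx.
have [m nPm lm] := omega1_well_founded (A := [set y | ~ P y]) (ex_intro _ x nPx).
by apply: nPm; apply: H => y; apply: contraPP => /lm; rewrite leNgt => /negP.
Qed.

(** Otherwise [0, omega_1) would be a union of countably many countable initial segments. *)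
Lemma omega1_bounded (u : nat -> omega1) : exists b, forall n, (u n <= b)%O.
Proof.
apply: contrapT => nb; apply: omega1_uncountable.
have -> : [set: omega1] = \bigcup_n [set y | (y <= u n)%O].
  apply/seteqP; split => // b _; apply: contrapT => nU; apply: nb; exists b => n.
  by rewrite leNgt; apply/negP => bu; apply: nU; exists n => //=; exact: ltW.
by apply: bigcup_countable => // n _; exact: omega1_countable_initial.
Qed.

Lemma omega1_gt_ex (x : omega1) : exists y, (x < y)%O.
Proof.
apply: contrapT => nx; apply: omega1_uncountable.
rewrite (_ : setT = [set y | (y <= x)%O]); first exact: omega1_countable_initial.
apply/seteqP; split => // y _ /=; rewrite leNgt; apply/negP => xy.
by apply: nx; exists y.
Qed.

Lemma omega1_succ_ex (x : omega1) :
  exists y, (x < y)%O /\ forall z, (x < z)%O -> (y <= z)%O.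
Proof.
have [y xy ly] := omega1_well_founded (A := [set y | (x < y)%O]) (omega1_gt_ex x).
by exists y.
Qed.

Definition omega1_succ x : omega1 := sval (cid (omega1_succ_ex x)).

Lemma lt_omega1_succ x : (x < omega1_succ x)%O.
Proof. by rewrite /omega1_succ; case: cid => y []. Qed.

Lemma omega1_succ_le x z : (x < z)%O -> (omega1_succ x <= z)%O.
Proof. by rewrite /omega1_succ; case: cid => y [] /= _; apply. Qed.

Lemma lt_omega1_succE x z : (z < omega1_succ x)%O = (z <= x)%O.
Proof.
apply/idP/idP => [|zx]; last exact: le_lt_trans zx (lt_omega1_succ x).
by rewrite [(z <= x)%O]leNgt; apply: contraTN => /omega1_succ_le; rewrite -leNgt.
Qed.

Lemma omega1_min_ex : exists x : omega1, forall y, (x <= y)%O.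
Proof.
have [x0 _] : [set: omega1] !=set0.
  apply/set0P/eqP => e; apply: omega1_uncountable; rewrite e; exact: countable0.
have [m _ lm] := omega1_well_founded (A := setT) (ex_intro _ x0 I).
by exists m => y; apply: lm.
Qed.

Definition omega1_0 : omega1 := sval (cid omega1_min_ex).

Lemma omega1_0_le x : (omega1_0 <= x)%O.
Proof. by rewrite /omega1_0; case: cid. Qed.

(** Each [0, x] is open, being the set of points below the successor of x, so only the left side of
    x matters. The first alternative is needed for x = 0, which has no a below it. *)
Lemma nbhs_omega1 (x : omega1) (A : set omega1) :
  nbhs x A <-> (forall y, (y <= x)%O -> A y) \/
    exists2 a, (a < x)%O & forall y, (a < y <= x)%O -> A y.
Proof.
rewrite itv_nbhsE; split.
  move=> [[l r] [/= oi]]; rewrite itv_boundlr => /andP[li ir] sub.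
  have le_r y : (y <= x)%O -> (BRight y <= r)%O.
    by move=> yx; apply: le_trans ir; rewrite bnd_simp.
  case: l oi li sub => [[] a|[]] /= oi mi sub.
  - by case: r oi {ir le_r sub} => [[]|[]].
  - right; exists a; first by move: mi; rewrite bnd_simp.
    move=> y /andP[ay yx]; apply: sub; rewrite /= itv_boundlr bnd_simp ay/=.
    exact: le_r.
  - left => y yx; apply: sub; rewrite /= itv_boundlr /=; exact: le_r.
  - by case: r oi {ir le_r sub} => [[]|[]].
move=> [H|[a ax H]].
  exists `]-oo, (omega1_succ x)[%O.
    by split; [by []|rewrite in_itv /= lt_omega1_succ].
  by move=> y; rewrite /= in_itv /= lt_omega1_succE => /H.
exists `]a, (omega1_succ x)[%O.
  by split; [by []|rewrite in_itv /= ax lt_omega1_succ].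
by move=> y; rewrite /= in_itv /= lt_omega1_succE => /H.
Qed.

Lemma nbhs_omega1S_Some (x : omega1) (A : set omega1S) :
  nbhs (Some x : omega1S) A <-> nbhs x (A \o Some).
Proof.
rewrite nbhs_omega1 itv_nbhsE; split.
  move=> [[l r] [/= oi]]; rewrite itv_boundlr => /andP[li ir] sub.
  have le_r y : (y <= x)%O -> (BRight (Some y : omega1S) <= r)%O.
    by move=> yx; apply: le_trans ir; rewrite bnd_simp.
  case: l oi li sub => [[] a|[]] /= oi mi sub.
  - by case: r oi {ir le_r sub} => [[]|[]].
  - case: a oi mi sub => [a|] oi mi sub; last by move: mi; rewrite bnd_simp.
    right; exists a; first by move: mi; rewrite bnd_simp.
    move=> y /andP[ay yx]; apply: sub; rewrite /= itv_boundlr bnd_simp.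
    by rewrite le_r// andbT.
  - left => y yx; apply: sub; rewrite /= itv_boundlr /=; exact: le_r.
  - by case: r oi {ir le_r sub} => [[]|[]].
have so (y : omega1S) : (y < Some (omega1_succ x))%O -> exists2 z, y = Some z & (z <= x)%O.
  by case: y => [y|//] yx; exists y => //; rewrite -lt_omega1_succE.
have xs : ((Some x : omega1S) < Some (omega1_succ x))%O by exact: lt_omega1_succ.
move=> [H|[a ax H]].
  exists `]-oo, (Some (omega1_succ x) : omega1S)[%O.
    by split; [by []|rewrite in_itv /=].
  by move=> y; rewrite /= in_itv /= => /so[z -> /H].
exists `](Some a : omega1S), (Some (omega1_succ x))[%O.
  by split=> //; rewrite in_itv /= xs andbT.
move=> y; rewrite /= in_itv /= => /andP[ay /so[z yz zx]]; subst y.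
by apply: H; rewrite zx andbT.
Qed.

Lemma nbhs_omega1_pt (A : set omega1S) :
  nbhs omega1_pt A <-> A omega1_pt /\ exists a, forall y, (a < y)%O -> A (Some y).
Proof.
split => [nA|].
  split; first exact: nbhs_singleton nA.
  move: nA; rewrite itv_nbhsE => -[[l r] [/= oi]].
  rewrite itv_boundlr => /andP[li ir] sub.
  have le_r y : (BRight (y : omega1S) <= r)%O.
    by apply: le_trans ir; rewrite bnd_simp; case: y.
  case: l oi li sub => [[] a|[]] /= oi mi sub.
  - by case: r oi {ir le_r sub} => [[]|[]].
  - case: a oi mi sub => [a|] oi mi sub; last by move: mi; rewrite bnd_simp.
    exists a => y ay; apply: sub; rewrite /= itv_boundlr bnd_simp.
    by rewrite le_r andbT.
  - by exists omega1_0 => y _; apply: sub; rewrite /= itv_boundlr /=; exact: le_r.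
  - by case: r oi {ir le_r sub} => [[]|[]].
move=> [AN [a Aa]]; rewrite itv_nbhsE.
exists `](Some a : omega1S), +oo[%O; first by split; [by []|rewrite in_itv].
by move=> [y|//]; rewrite /= in_itv /= andbT => ay; apply: Aa.
Qed.

(* For x = 0 the condition on all a < x is vacuous, hence the restriction to
   x > 0. *)
Definition club (D : set omega1) :=
  (forall x, exists2 y, D y & (x < y)%O) /\
  (forall x, (omega1_0 < x)%O ->
     (forall a, (a < x)%O -> exists2 y, D y & (a < y <= x)%O) -> D x).

Definition closed_under (g : omega1 -> omega1) : set omega1 :=
  [set x | (omega1_0 < x)%O /\ forall y, (y < x)%O -> (g y < x)%O].

Lemma omega1_bound_initial (g : omega1 -> omega1) x :
  exists b, forall y, (y <= x)%O -> (g y <= b)%O.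
Proof.
have /countable_injP[f finj] := omega1_countable_initial x.
have /choice[u uP] n : exists b, forall y, (y <= x)%O -> f y = n -> (g y <= b)%O.
  have [[y yx yn]|ny] := pselect (exists2 y, (y <= x)%O & f y = n).
    by exists (g y) => z zx zn; rewrite (finj z y) ?inE// zn.
  (* No y <= x has code n, so any bound serves; x is a default. *)
  by exists x => y yx yn; exfalso; apply: ny; exists y.
have [b ub] := omega1_bounded u; exists b => y yx.
exact: le_trans (uP _ _ yx erefl) (ub _).
Qed.

(** For unboundedness, iterate from x a step that dominates g on initial segments; the supremum of
    the iterates is closed under g. *)
Lemma closed_under_club g : club (closed_under g).
Proof.
split => [x|x x0 lx]; last first.
  split => // y /lx[z [_ gz] /andP[yz zx]]; exact: lt_le_trans (gz _ yz) zx.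
have [h hP] := choice (omega1_bound_initial g).
(* The first successor makes the iterates strictly increasing, so that none reaches their supremum
   m; the second bounds g strictly on [0, b]. *)
pose nx b := Order.max (omega1_succ b) (omega1_succ (h b)).
pose u n := iter n nx x.
have [m um lm] := omega1_well_founded (A := [set b | forall n, (u n <= b)%O])
  (omega1_bounded u).
have ult n : (u n < m)%O.
  by apply: lt_le_trans (um n.+1); rewrite /= lt_max lt_omega1_succ.
exists m; last exact: (ult 0%N).
split; first exact: le_lt_trans (omega1_0_le _) (ult 0%N).
move=> y ym; have [n yn] : exists n, (y < u n)%O.
  apply: contrapT => ny; suff /lm : forall n, (u n <= y)%O by rewrite leNgt ym.
  by move=> n; rewrite leNgt; apply/negP => yn; apply: ny; exists n.
apply: le_lt_trans (ult n.+1).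
rewrite /= /nx le_max; apply/orP; right.
by apply/ltW; rewrite lt_omega1_succE; apply: hP; exact: ltW.
Qed.

(** Let d and e pick larger elements of D and of E. A positive point closed under the maximum of d
    and e is a limit of both sets, hence lies in both. *)
Lemma clubI D E : club D -> club E -> club (D `&` E).
Proof.
move=> [uD cD] [uE cE]; split => [x|x x0 lx]; last first.
  split.
  - by apply: cD => // a /lx[y [Dy _] ayx]; exists y.
  - by apply: cE => // a /lx[y [_ Ey] ayx]; exists y.
have /choice[d dP] : forall x, exists y, D y /\ (x < y)%O.
  by move=> a; have [y] := uD a; exists y.
have /choice[e eP] : forall x, exists y, E y /\ (x < y)%O.
  by move=> a; have [y] := uE a; exists y.
have [+ _] := closed_under_club (fun y => Order.max (d y) (e y)).
move=> /(_ x)[y [y0 hy] xy]; exists y => //; split.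
- apply: cD => // a /hy; rewrite gt_max => /andP[/ltW da _].
  by exists (d a); [case: (dP a)|case: (dP a) => _ ->].
- apply: cE => // a /hy; rewrite gt_max => /andP[_ /ltW da].
  by exists (e a); [case: (eP a)|case: (eP a) => _ ->].
Qed.

Lemma clubT : club setT.
Proof. by split => // x; have [y] := omega1_gt_ex x; exists y. Qed.

Lemma club_above x : club [set y | (x < y)%O].
Proof.
split => [z|y y0 ly].
  have [y] := omega1_gt_ex (Order.max x z).
  by rewrite gt_max => /andP[xy zy]; exists y.
by have [z xz /andP[_ zy]] := ly _ y0; exact: lt_le_trans xz zy.
Qed.

(** * Functionals on [C_0[0, omega_1)] *)

Section operators.
Variables (R : realType) (s : scalars).
Local Notation K := (scalar_field R s).
Local Notation C := (C_omega1S R s).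
Local Notation C0 := (C0_omega1 R s).

Lemma scalar_archi (x : K) : 0 <= x -> exists n : nat, x < n%:R.
Proof.
(* The first witness typechecks for complex scalars only; the second is the fallback for real
   ones. *)
case: s x => /= x x0; exists (Num.bound (complex.Re (x : R[i]%C))) || exists (Num.bound x).
  exact: archi_boundP.
move: x x0 => [a b]; rewrite lecE /= => /andP[/eqP -> a0].
have -> : (Num.bound a)%:R = ((Num.bound a)%:R)%:C%C :> R[i]%C by rewrite rmorph_nat.
by rewrite ltcE /= eqxx; exact: archi_boundP.
Qed.

Lemma scalar_archi_inv (e : K) : 0 < e -> exists n : nat, n.+1%:R^-1 <= e.
Proof.
move=> e0; have [|n en] := @scalar_archi e^-1; first by rewrite invr_ge0 ltW.
exists n; rewrite invf_ple ?posrE ?ltr0n//.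
by rewrite (le_trans (ltW en))// ler_nat.
Qed.

Lemma norm_small_eq0 (x c : K) : 0 <= c -> (forall e, 0 < e -> `|x| <= c * e) ->
  x = 0.
Proof.
move=> c0 H; apply/eqP; apply: contraT => x0.
(* Dividing by c + 1 rather than by c allows c = 0. *)
have c1 : 0 < c + 1 by rewrite ltr_wpDl.
have /H : 0 < `|x| / (c + 1) by rewrite divr_gt0// normr_gt0.
rewrite mulrA ler_pdivlMr// mulrDr mulr1 (mulrC c) gerDl => nx.
by move: x0; rewrite -normr_le0 nx.
Qed.

Lemma continuous_atP (X : topologicalType) (h : X -> K) x :
  {for x, continuous h} <->
  forall e, 0 < e -> nbhs x [set y | `|h x - h y| <= e].
Proof. by split => /cvgrPdist_le. Qed.

Lemma continuous_funB (X : topologicalType) (f g : X -> K) :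
  continuous f -> continuous g -> continuous (fun x => f x - g x).
Proof. by move=> cf cg x; apply: cvgB; [exact: cf|exact: cg]. Qed.

Lemma continuous_funD (X : topologicalType) (f g : X -> K) :
  continuous f -> continuous g -> continuous (fun x => f x + g x).
Proof. by move=> cf cg x; apply: cvgD; [exact: cf|exact: cg]. Qed.

Lemma continuous_fun_cst (X : topologicalType) (a : K) :
  continuous (fun _ : X => a).
Proof. by move=> x; exact: cst_continuous. Qed.

Lemma continuous_omega1P (h : omega1 -> K) : continuous h <->
  forall x e, 0 < e -> (forall y, (y <= x)%O -> `|h x - h y| <= e) \/
    exists2 a, (a < x)%O & forall y, (a < y <= x)%O -> `|h x - h y| <= e.
Proof.
split => [ch x e e0|H x].
  apply/(nbhs_omega1 x [set y | `|h x - h y| <= e]).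
  by move: e e0; exact/continuous_atP/ch.
apply/continuous_atP => e e0.
by apply/(nbhs_omega1 x [set y | `|h x - h y| <= e]); exact: H.
Qed.

(** For each n, h is within 1/(n+1) of its value at omega_1 beyond some countable ordinal; countably
    many such ordinals have a common bound. *)
Lemma eventually_cst (h : omega1S -> K) : {for omega1_pt, continuous h} ->
  exists a, forall y, (a < y)%O -> h (Some y) = h omega1_pt.
Proof.
move=> /continuous_atP ch.
have /choice[u uP] n : exists a, forall y, (a < y)%O ->
    `|h omega1_pt - h (Some y)| <= n.+1%:R^-1.
  have /nbhs_omega1_pt[_ [a aP]] := ch n.+1%:R^-1 ltac:(by rewrite invr_gt0 ltr0n).
  by exists a.
have [b bP] := omega1_bounded u; exists b => y bY; apply/esym/eqP.
rewrite -subr_eq0; apply/eqP/(@norm_small_eq0 _ 1) => // e e0; rewrite mul1r.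
have [n ne] := scalar_archi_inv e0; apply: le_trans ne.
by apply: uP; exact: le_lt_trans (bP n) bY.
Qed.

Lemma continuous_Some (h : omega1S -> K) : continuous h ->
  continuous (fun x : omega1 => h (Some x)).
Proof. by move=> ch x A /ch /nbhs_omega1S_Some. Qed.

Lemma continuous_omega1S (h : omega1S -> K) a :
  continuous (fun x : omega1 => h (Some x)) ->
  (forall y, (a < y)%O -> h (Some y) = h omega1_pt) -> continuous h.
Proof.
move=> ch ha [x|] A nA; first by apply/nbhs_omega1S_Some; exact: ch.
apply/nbhs_omega1_pt; split; first exact: nbhs_singleton nA.
by exists a => y /ha /= ->; exact: nbhs_singleton nA.
Qed.

Lemma C0_le_norm (f : C0) x : `|f x| <= `|f|.
Proof. exact: (supnorm_ub (@C0_omega1_bounded R s f)). Qed.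

Lemma C0_norm_le (f : C0) M : 0 <= M -> (forall x, `|f x| <= M) -> `|f| <= M.
Proof. by move=> M0 fM; apply: supnorm_le. Qed.

Lemma C0BE (f g : C0) x : (f - g) x = f x - g x.
Proof. by []. Qed.

Lemma C0DE (f g : C0) x : (f + g) x = f x + g x.
Proof. by []. Qed.

Lemma C0ZE (a : K) (f : C0) x : (a *: f) x = a * f x.
Proof. by []. Qed.

(** Multiplying h by the indicator of [0, c] preserves continuity because [0, c] is clopen. *)
Fact cut_subproof (h : omega1 -> K) (ch : continuous h) c :
  (fun x => if (x <= c)%O then h x else 0) \in C0_omega1_pred (R := R) (s := s).
Proof.
apply/asboolP; split; last first.
  have [a ca] := omega1_gt_ex c; exists a => b ab.
  by rewrite leNgt (lt_le_trans ca ab).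
apply/continuous_omega1P => x e e0; have [xc|cx] := leP x c; last first.
  right; exists c => // y /andP[cy _].
  by rewrite leNgt cy subrr normr0 ltW.
have /continuous_omega1P/(_ x e e0)[H|[a ax H]] := ch.
  by left => y yx; rewrite (le_trans yx xc) H.
by right; exists a => // y /andP[ay yx]; rewrite (le_trans yx xc) H// ay.
Qed.

Definition cut h (ch : continuous h) c : C0 := C0Omega1 (cut_subproof ch c).

Definition cut1 : omega1 -> C0 := cut (@continuous_fun_cst omega1 1).

Definition cutf (f : C0) : omega1 -> C0 := cut (@C0_omega1_continuous R s f).

Lemma functionalB (X : normedModType K) (phi : bounded_operator X K) f g :
  phi (f - g) = phi f - phi g.
Proof. exact: linearB. Qed.

Lemma functionalZ (X : normedModType K) (phi : bounded_operator X K) a f :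
  phi (a *: f) = a * phi f.
Proof. exact: linearZ. Qed.

(* Otherwise n disjointly supported functions of norm at most one, on each of
   which psi is at least e, would add up to one of norm at most one on which
   psi is at least n e. *)
Lemma functional_small_tail (psi : bounded_operator C0 K) (e : K) : 0 < e ->
  exists c, forall f : C0, (forall y, (y <= c)%O -> f y = 0) ->
  `|psi f| <= e * `|f|.
Proof.
move=> e0; apply: contrapT => nc.
have P1 c : exists f : C0,
    [/\ forall y, (y <= c)%O -> f y = 0, `|f| <= 1 & e <= psi f].
  apply: contrapT => nf; apply: nc; exists c => f f0.
  have [->|n0] := eqVneq f 0; first by rewrite linear0 !normr0 mulr0.
  have nf0 : 0 < `|f| by rewrite normr_gt0.
  have er : e * `|f| \is Num.real by rewrite realE mulr_ge0// ltW.
  rewrite real_leNgt ?normr_real//.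
  apply/negP => ef; apply: nf.
  have p0 : psi f != 0.
    by rewrite -normr_gt0 (le_lt_trans _ ef)// mulr_ge0// ltW.
  (* The unimodular factor [|psi f| / psi f] turns the value of psi into its modulus, so that sums
     of such values cannot cancel; the last factor normalises f. *)
  exists ((`|psi f| / psi f / `|f|) *: f); split.
  - by move=> y /f0 fy; rewrite C0ZE fy mulr0.
  - rewrite normrZ !normrM !normfV !normr_id divff ?normr_eq0//.
    by rewrite mul1r mulVf ?normr_eq0.
  - rewrite functionalZ mulrAC divfK//.
    by rewrite ler_pdivlMr// ltW.
have Pn n : forall a0, exists f : C0,
    [/\ forall y, (y <= a0)%O -> f y = 0, `|f| <= 1 & e *+ n <= psi f].
  elim: n => [|n IH] a0.
    by exists 0; split => //; rewrite ?linear0 ?normr0 ?mulr0n.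
  have [f [f0 f1 fe]] := IH a0.
  have [a fa] := C0_omega1_vanish f.
  (* Since f vanishes from a on, g and f have disjoint supports and the norm of g + f stays at most
     one. *)
  have [g [g0 g1 ge]] := P1 (Order.max a0 a).
  exists (g + f); split.
  - by move=> y yc; rewrite C0DE f0// g0 ?addr0// le_max yc.
  - apply: C0_norm_le => // x; rewrite C0DE.
    have [xa|/ltW/fa ->] := leP x a; last first.
      by rewrite addr0; exact: le_trans (C0_le_norm g x) g1.
    have -> : g x = 0 by apply: g0; rewrite le_max xa orbT.
    by rewrite add0r; exact: le_trans (C0_le_norm f x) f1.
  - by rewrite linearD mulrS lerD.
have [|n] := @scalar_archi (`|psi| / e); first by rewrite divr_ge0// ltW.
rewrite ltr_pdivrMr// => pn.
have [f [_ f1 fe]] := Pn n omega1_0.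
have : `|psi f| <= `|psi|.
  by rewrite (le_trans (bounded_operator_norm_ge _ _))// ler_piMr.
rewrite ger0_norm; last by rewrite (le_trans _ fe)// mulrn_wge0// ltW.
move=> /(le_trans fe); rewrite -mulr_natl => /le_lt_trans/(_ pn).
by rewrite ltxx.
Qed.

(** A common bound of the tails obtained for e = 1/(n+1) works for all n at once. *)
Lemma functional_tail (psi : bounded_operator C0 K) :
  exists c, forall f : C0, (forall y, (y <= c)%O -> f y = 0) -> psi f = 0.
Proof.
have /choice[u uP] n := @functional_small_tail psi n.+1%:R^-1
  ltac:(by rewrite invr_gt0 ltr0n).
have [b bP] := omega1_bounded u; exists b => f f0.
apply: (@norm_small_eq0 _ `|f|) => // e e0.
have [n ne] := scalar_archi_inv e0.
rewrite (le_trans (uP n f _))//.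
  by move=> y yn; apply: f0; exact: le_trans yn (bP n).
by rewrite mulrC ler_wpM2l.
Qed.

(* Transfinite induction on c: near c from the left f is almost constant, so
   f 1_[0,c] is close to f 1_[0,a] + f(c) 1_(a,c] for some a < c. *)
Lemma functional_cut (psi : bounded_operator C0 K) x :
  (forall c, (c < x)%O -> psi (cut1 c) = 0) ->
  forall (f : C0) c, (c <= x)%O -> psi (cutf f c) = f c * psi (cut1 c).
Proof.
move=> H f; apply: omega1_ind => c IH cx; apply/eqP; rewrite -subr_eq0; apply/eqP.
apply: (@norm_small_eq0 _ `|psi|) => // e e0.
have bound (g : C0) : (forall y, `|g y| <= e) -> `|psi g| <= `|psi| * e.
  move=> ge; rewrite (le_trans (bounded_operator_norm_ge _ _))//.
  by rewrite ler_wpM2l// C0_norm_le// ltW.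
have e0' : `|0 : K| <= e by rewrite normr0 ltW.
have /continuous_omega1P/(_ c e e0)[fe|[a ac fe]] := @C0_omega1_continuous R s f.
  have -> : psi (cutf f c) - f c * psi (cut1 c) = psi (cutf f c - f c *: cut1 c).
    by rewrite functionalB functionalZ.
  apply: bound => y; rewrite C0BE C0ZE /=; case: ifPn => yc; last first.
    by rewrite mulr0 subrr.
  by rewrite mulr1 distrC fe.
(* Subtracting the parts on [0, a] changes nothing: psi kills [cutf f a] by induction and [cut1 a]
   by hypothesis. What remains lives on (a, c], where f is within e of f(c). *)
have -> : psi (cutf f c) - f c * psi (cut1 c) =
    psi (cutf f c - cutf f a - f c *: (cut1 c - cut1 a)).
  rewrite !(functionalB, functionalZ) /= (H a) ?(lt_le_trans ac)// subr0.
  by rewrite (IH a ac) ?(ltW (lt_le_trans ac _))// (H a) ?(lt_le_trans ac)// mulr0 subr0.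
apply: bound => y; rewrite C0BE C0ZE !C0BE /=.
have [ya|ay] := leP y a.
  by rewrite (le_trans ya (ltW ac)) !subrr mulr0 subrr.
case: ifPn => yc; last by rewrite subrr mulr0 subrr.
by rewrite !subr0 mulr1 distrC fe// ay.
Qed.

(* On a club, psi_x kills every f supported in [0, x) because it kills the
   indicators of [0, y], y < x, and every f supported in (x, omega_1) because
   the psi_y f, y < x, vanish and tend to psi_x f; so only f(x) matters. *)
Lemma functional_family_diagonal (psi : omega1 -> bounded_operator C0 K) :
  (forall f, continuous (fun x => psi x f)) ->
  (forall f, exists a, forall x, (a <= x)%O -> psi x f = 0) ->
  exists D (c : omega1 -> K), club D /\ forall x (f : C0), D x -> psi x f = c x * f x.
Proof.
move=> cpsi vpsi.
have /choice[t tP] := fun x => functional_tail (psi x).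
have /choice[v vP] := fun x => vpsi (cut1 x).
(* For x closed under g, the entry t makes psi_y, y < x, kill functions vanishing on [0, x]; the
   entry v makes psi_x kill indicators of [0, y], y < x; the successor makes x a limit. *)
pose g x := Order.max (omega1_succ x) (Order.max (t x) (v x)).
exists (closed_under g), (fun x => psi x (cut1 x)); split.
  exact: closed_under_club.
move=> x f [x0 gx].
have tail (h : C0) : (forall y, (y <= x)%O -> h y = 0) -> psi x h = 0.
  move=> h0; have psi0 y : (y < x)%O -> psi y h = 0.
    move=> yx; apply: tP => z zt; apply: h0; apply: le_trans zt _.
    by have := gx _ yx; rewrite !gt_max => /and3P[_ /ltW].
  apply: (@norm_small_eq0 _ 1) => // e e0; rewrite mul1r.
  have /continuous_omega1P/(_ x e e0)[he|[a ax he]] := cpsi h.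
    (* Here 0 is the point below x at which psi vanishes on h; this is where x > 0 enters. *)
    by have := he _ (ltW x0); rewrite (psi0 _ x0) subr0.
  have sx : (omega1_succ a < x)%O by have := gx _ ax; rewrite gt_max => /andP[].
  have := he (omega1_succ a); rewrite (psi0 _ sx) subr0; apply.
  by rewrite lt_omega1_succ ltW.
have -> : psi x f = psi x (cutf f x) + psi x (f - cutf f x).
  by rewrite functionalB addrC subrK.
rewrite (tail (f - cutf f x)) ?addr0; last first.
  by move=> y yx; rewrite C0BE /= yx subrr.
rewrite (@functional_cut _ x) 1?mulrC// => c cx; apply: vP.
by have := gx _ cx; rewrite !gt_max => /and3P[_ _ /ltW].
Qed.

End operators.

(** * Members of the ideal vanish on a club *)

Section ideal.
Variables (R : realType) (s : scalars).
Local Notation K := (scalar_field R s).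
Local Notation C := (C_omega1S R s).
Local Notation C0 := (C0_omega1 R s).

Fact C0_evaluation_subproof (x : omega1) :
  (fun f : C0 => f x : K) \in bounded_operator_pred (X := C0) (Y := K).
Proof.
apply/asboolP; split => //; exists 1 => f; rewrite mul1r; exact: C0_le_norm.
Qed.

Definition C0_evaluation x : bounded_operator C0 K :=
  BoundedOperator (C0_evaluation_subproof x).

Lemma operator_norm_le (X Y : normedModType K) (T : bounded_operator X Y) M :
  0 <= M -> (forall x, `|T x| <= M * `|x|) -> `|T| <= M.
Proof.
move=> M0 TM; apply: supnorm_le => // x /= x1.
by rewrite (le_trans (TM x))// ler_piMr.
Qed.

Lemma operatorP (X Y : normedModType K) (S T : bounded_operator X Y) :
  (forall x, S x = T x) -> S = T.
Proof. by move=> ST; apply/val_inj/funext. Qed.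

Lemma operatorBE (X Y : normedModType K) (S T : bounded_operator X Y) x :
  (S - T) x = S x - T x.
Proof. by []. Qed.

Lemma operator_sumE (X Y : normedModType K) (I : Type) (r : seq I) (P : pred I)
    (F : I -> bounded_operator X Y) x :
  (\sum_(i <- r | P i) F i) x = \sum_(i <- r | P i) F i x.
Proof. by elim/big_rec2 : _ => // i y1 y2 _ <-. Qed.

Lemma C_le_norm (f : C) x : `|f x| <= `|f|.
Proof. exact: (supnorm_ub (@C_omega1S_bounded R s f)). Qed.

Lemma C_norm_le (f : C) M : 0 <= M -> (forall x, `|f x| <= M) -> `|f| <= M.
Proof. by move=> M0 fM; apply: supnorm_le. Qed.

(** This is the indicator of the clopen interval (c, omega_1]; writing it through [cut1] gives
    continuity below omega_1. *)
Fact top_indicator_subproof (c : omega1) :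
  (fun x : omega1S => if x is Some y then 1 - cut1 R s c y else 1)
    \in C_omega1S_pred (R := R) (s := s).
Proof.
apply/asboolP; apply: (@continuous_omega1S _ _ _ c) => [|y cy].
  apply: continuous_funB; first exact: continuous_fun_cst.
  exact: C0_omega1_continuous.
by rewrite /= leNgt cy subr0.
Qed.

Definition top_indicator c : C := COmega1S (top_indicator_subproof c).

Lemma top_indicator_SomeE c y : top_indicator c (Some y) = (c < y)%O%:R.
Proof. by rewrite /= ltNge; case: ifP; rewrite ?subrr ?subr0. Qed.

Lemma top_indicator_norm c : `|top_indicator c| <= 1.
Proof.
apply: C_norm_le => // -[y|]; last by rewrite normr1.
by rewrite top_indicator_SomeE normr_nat; case: (c < y)%O.
Qed.

(** Some finite partial sum is within e of phi in norm. Once c is past every countable ordinal in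
    that sum, the indicator of (c, omega_1] detects only the coefficient at omega_1. *)
Lemma functional_coefficients_top (phi : bounded_operator C K) g (e : K) :
  functional_coefficients phi g -> 0 < e ->
  exists a, forall c, (a <= c)%O -> `|phi (top_indicator c) - g omega1_pt| <= e.
Proof.
move=> [_ /cvgrPdist_le cg] e0; have [A0 _ A0e] := cg (summability.totally_filter) e e0.
(* Adjoining omega_1 ensures that its coefficient occurs in the sum. *)
pose A := (omega1_pt |` A0)%fset.
have Ae := A0e A (fsubsetUr _ _).
(* The sequence lists the countable ordinals of A; omega_1 and indices out of range give 0. *)
have [a aP] := omega1_bounded
  (fun n => if nth omega1_pt A n is Some y then y else omega1_0).
exists a => c ac.
have NA : omega1_pt \in A by rewrite !inE eqxx.
have sumE : summability.partial_sum
    (fun gamma => g gamma *: point_evaluation R s gamma) A (top_indicator c)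
    = g omega1_pt.
  rewrite /summability.partial_sum operator_sumE (bigD1 [` NA]%fset)//=.
  rewrite big1 ?addr0 => [|[i iA] /= iN]; first exact: mulr1.
  case: i iA iN => [y|] yA yN; last by move: yN; rewrite -val_eqE.
  have ya : (y <= a)%O.
    by have := aP (index (Some y) A); rewrite nth_index.
  change (g (Some y) * top_indicator c (Some y) = 0).
  by rewrite top_indicator_SomeE ltNge (le_trans ya ac) mulr0.
rewrite -sumE -operatorBE (le_trans (bounded_operator_norm_ge _ _))//.
rewrite -[leRHS]mulr1 ler_pM//; exact: top_indicator_norm.
Qed.

Lemma Loy_Willis_ideal_vanish (T : bounded_operator C0 C0) :
  Loy_Willis_ideal T ->
  exists2 D, club D & forall x f, D x -> T f x = 0.
Proof.
move=> [U [V [[UK VK] [m mP mc]]]].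
have [| |D1 [a [cD1 aP]]] :=
    @functional_family_diagonal R s (fun x => C0_evaluation x \oB T).
- by move=> f; exact: (@C0_omega1_continuous R s (T f)).
- by move=> f; exact: (C0_omega1_vanish (T f)).
pose psi x := (point_evaluation R s (Some x) - point_evaluation R s omega1_pt) \oB V.
have [| |D2 [c [cD2 cP]]] := @functional_family_diagonal R s psi.
- move=> f; apply: continuous_funB; last exact: continuous_fun_cst.
  exact: continuous_Some (@C_omega1S_continuous _ _ (V f)).
- move=> f; have [b bP] := eventually_cst (@C_omega1S_continuous _ _ (V f) omega1_pt).
  have [b' bb'] := omega1_gt_ex b; exists b' => x b'x.
  change (V f (Some x) - V f omega1_pt = 0).
  by rewrite bP ?subrr// (lt_le_trans bb').
(* Beyond b, the entries in column omega_1 equal the one in row omega_1. This is the only use of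
   membership in the ideal beyond the existence of U and of the matrix. *)
have [b bP] := eventually_cst mc.
exists (D1 `&` D2 `&` [set x | (b < x)%O]).
  by apply: clubI; [exact: clubI|exact: club_above].
move=> x f [[D1x D2x] /= bx].
have aE g : T g x = a x * g x by exact: (aP x g D1x).
have cE g : V g (Some x) - V g omega1_pt = c x * g x by exact: (cP x g D2x).
suff a0 : a x = 0 by rewrite aE a0 mul0r.
(* Apply [cE] to T U h, then [aE], then [cE] again to U h, using V U h = h; the factor c(x) is
   absorbed without being computed. *)
have row h : (V \oB T \oB U) h (Some x) - (V \oB T \oB U) h omega1_pt =
    a x * (h (Some x) - h omega1_pt).
  rewrite -[in RHS](UK h) cE mulrCA -aE; exact: cE.
apply: (@norm_small_eq0 _ _ _ 2) => // e e0.
have [d1 d1P] := functional_coefficients_top (mP (Some x)) e0.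
have [d2 d2P] := functional_coefficients_top (mP omega1_pt) e0.
(* As d >= x, the test function is 0 at x and 1 at omega_1, so [row] reads q - p = - a(x). As d >=
   d1 and d >= d2, both p and q are within e of the same entry, whence the constant 2. *)
pose d := Order.max x (Order.max d1 d2).
have xd : (x <= d)%O by rewrite le_max lexx.
have d1d : (d1 <= d)%O by rewrite !le_max lexx orbT.
have d2d : (d2 <= d)%O by rewrite !le_max lexx !orbT.
have := row (top_indicator d).
rewrite top_indicator_SomeE ltNge xd /= sub0r mulrN1.
set p := _ _ omega1_pt; set q := _ _ (Some x) => qp.
have pe : `|p - m omega1_pt omega1_pt| <= e by exact: d2P.
have qe : `|q - m omega1_pt omega1_pt| <= e by rewrite -(bP _ bx); exact: d1P.
have -> : a x = (p - m omega1_pt omega1_pt) - (q - m omega1_pt omega1_pt).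
  by rewrite opprB addrA subrK -opprB qp opprK.
by rewrite mulr_natl mulr2n (le_trans (ler_normB _ _))// lerD.
Qed.

End ideal.

(** * The projections *)

Section next.
Variables (D : set omega1) (cD : club D).

Lemma club_next_ex x : exists y,
  [/\ D y, (x <= y)%O & forall z, D z -> (x <= z)%O -> (y <= z)%O].
Proof.
have [|y [Dy xy] ly] := omega1_well_founded (A := [set y | D y /\ (x <= y)%O]).
  by have [y Dy xy] := cD.1 x; exists y; split => //; exact: ltW.
by exists y; split => // z Dz xz; apply: ly.
Qed.

Definition club_next x : omega1 := sval (cid (club_next_ex x)).

Lemma club_next_in x : D (club_next x).
Proof. by rewrite /club_next; case: cid => y []. Qed.

Lemma club_next_ge x : (x <= club_next x)%O.
Proof. by rewrite /club_next; case: cid => y []. Qed.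

Lemma club_next_le x z : D z -> (x <= z)%O -> (club_next x <= z)%O.
Proof. by rewrite /club_next; case: cid => y [/= _ _]; apply. Qed.

Lemma club_next_id x : D x -> club_next x = x.
Proof. by move=> Dx; apply/le_anti; rewrite club_next_ge club_next_le. Qed.

Lemma club_next_homo x y : (x <= y)%O -> (club_next x <= club_next y)%O.
Proof.
move=> xy; apply: club_next_le; first exact: club_next_in.
exact: le_trans xy (club_next_ge y).
Qed.

(** Write d for [club_next]. For y <= x, monotonicity gives d(y) <= d(x), and d(y) >= y keeps d(y)
    above any a < x. If x <= a < d(x), then x is not in D, and for x > 0 closedness of D makes d
    constant on some (b, x]. *)
Lemma continuous_club_next : continuous club_next.
Proof.
move=> x A /nbhs_omega1 nA; apply/nbhs_omega1.
case: nA => [H|[a ax H]].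
  by left => y yx; apply: H; exact: club_next_homo.
have [{}ax|xa] := ltP a x.
  right; exists a => // y /andP[ay yx]; apply: H.
  by rewrite (lt_le_trans ay (club_next_ge y)) club_next_homo.
have nDx : ~ D x by move=> /club_next_id dx; move: ax; rewrite dx ltNge xa.
have [x0|x0] := leP x omega1_0.
  left => y yx; have -> : y = x.
    by apply/le_anti; rewrite yx (le_trans x0)// omega1_0_le.
  by apply: H; rewrite ax lexx.
have [b bx nb] : exists2 b, (b < x)%O & forall y, D y -> ~~ (b < y <= x)%O.
  apply: contrapT => nb; apply: nDx; apply: cD.2 => // b bx.
  apply: contrapT => ny; apply: nb; exists b => // y Dy.
  by apply/negP => byx; apply: ny; exists y.
right; exists b => // y /andP[by_ yx].
suff dyx : club_next y = club_next x by rewrite /= dyx; apply: H; rewrite ax lexx.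
apply/le_anti; rewrite club_next_homo//=; apply: club_next_le.
  exact: club_next_in.
have := nb _ (club_next_in y).
by rewrite (lt_le_trans by_ (club_next_ge y)) /= -ltNge => /ltW.
Qed.

End next.

(** * Finite ordinals and the shift homeomorphism *)

Definition fin_ordinal n : omega1 := iter n omega1_succ omega1_0.

Lemma fin_ordinal_ltS n : (fin_ordinal n < fin_ordinal n.+1)%O.
Proof. exact: lt_omega1_succ. Qed.

Lemma fin_ordinal_le : {mono fin_ordinal : m n / (m <= n)%N >-> (m <= n)%O}.
Proof. by apply: le_mono => m n; apply: (homo_ltn lt_trans fin_ordinal_ltS). Qed.

Lemma fin_ordinal_lt : {mono fin_ordinal : m n / (m < n)%N >-> (m < n)%O}.
Proof. by move=> m n; rewrite ltNge fin_ordinal_le -ltnNge. Qed.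

Lemma fin_ordinal_inj : injective fin_ordinal.
Proof.
by move=> m n /eqP; rewrite eq_le !fin_ordinal_le -eqn_leq => /eqP.
Qed.

Definition finite_ordinal x := exists n, x = fin_ordinal n.

Lemma finite_ordinal_initial n y : (y <= fin_ordinal n)%O -> finite_ordinal y.
Proof.
elim: n => [|n IH] yn.
  by exists 0%N; apply/le_anti; rewrite yn omega1_0_le.
have [yn'|/omega1_succ_le ny] := leP y (fin_ordinal n); first exact: IH.
by exists n.+1; apply/le_anti; rewrite yn.
Qed.

Lemma infinite_ordinal_gt x n : ~ finite_ordinal x -> (fin_ordinal n < x)%O.
Proof. by rewrite ltNge => nx; apply/negP => /finite_ordinal_initial. Qed.

Lemma finite_ordinal_bound : exists a, forall n, (fin_ordinal n < a)%O.
Proof.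
have [b bP] := omega1_bounded fin_ordinal.
have [a ba] := omega1_gt_ex b; exists a => n; exact: le_lt_trans (bP n) ba.
Qed.

(* The shift of the first omega ordinals, fixing all others, is a homeomorphism
   of [0, omega_1) onto [1, omega_1). *)
Definition shift x := if `[< finite_ordinal x >] then omega1_succ x else x.

(** The inverse of [shift] on [1, omega_1), extended to 0, which [shift] does not reach, by the
    value 0. *)
Definition unshift x : omega1 :=
  if pselect (exists n, x = fin_ordinal n.+1) is left e
  then fin_ordinal (sval (cid e)) else x.

Lemma shift_fin n : shift (fin_ordinal n) = fin_ordinal n.+1.
Proof. by rewrite /shift asboolT//; exists n. Qed.

Lemma shift_infinite x : ~ finite_ordinal x -> shift x = x.
Proof. by move=> nx; rewrite /shift asboolF. Qed.

Lemma unshift_fin n : unshift (fin_ordinal n.+1) = fin_ordinal n.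
Proof.
rewrite /unshift; case: pselect => [e|]; last by case; exists n.
by case: cid => m em /=; have [->] := fin_ordinal_inj em.
Qed.

Lemma unshift0 : unshift omega1_0 = omega1_0.
Proof.
rewrite /unshift; case: pselect => // e.
by case: cid => m em; have := fin_ordinal_inj (em : fin_ordinal 0 = _).
Qed.

Lemma unshift_infinite x : ~ finite_ordinal x -> unshift x = x.
Proof.
move=> nx; rewrite /unshift; case: pselect => // e; exfalso; apply: nx.
by case: e => n ->; exists n.+1.
Qed.

Lemma shiftK : cancel shift unshift.
Proof.
move=> x; have [[n ->]|nx] := pselect (finite_ordinal x).
  by rewrite shift_fin unshift_fin.
by rewrite shift_infinite// unshift_infinite.
Qed.

Lemma unshiftK x : (omega1_0 < x)%O -> shift (unshift x) = x.
Proof.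
have [[[|n] ->]|nx] := pselect (finite_ordinal x); first by rewrite ltxx.
  by rewrite unshift_fin shift_fin.
by rewrite unshift_infinite// shift_infinite.
Qed.

Lemma shift_gt0 x : (omega1_0 < shift x)%O.
Proof.
have [[n ->]|nx] := pselect (finite_ordinal x).
  by rewrite shift_fin (fin_ordinal_lt 0).
by rewrite shift_infinite// (infinite_ordinal_gt 0).
Qed.

(** Finite ordinals are isolated. Infinite ones are fixed, and finite ones move down by at most one
    step, so phi maps (k+1, x] into (k, x] for infinite x; this covers [shift] and [unshift]
    together. *)
Lemma continuous_near_shift (phi : omega1 -> omega1) :
  (forall n, exists2 m, phi (fin_ordinal n) = fin_ordinal m & (n <= m.+1)%N) ->
  (forall x, ~ finite_ordinal x -> phi x = x) -> continuous phi.
Proof.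
move=> fphi iphi x A nA; apply/nbhs_omega1.
have [[n xn]|nx] := pselect (finite_ordinal x).
  have Ax : A (phi x) by exact: nbhs_singleton nA.
  subst x; case: n Ax {nA} => [|n] Ax.
    left => y y0; suff -> : y = fin_ordinal 0 by [].
    by apply/le_anti; rewrite y0 omega1_0_le.
  right; exists (fin_ordinal n); first exact: fin_ordinal_ltS.
  move=> y /andP[/omega1_succ_le ny yn].
  by suff -> : y = fin_ordinal n.+1 by []; apply/le_anti; rewrite yn ny.
move: nA; rewrite iphi// => /nbhs_omega1[H|[a ax H]].
  left => y yx; apply: H; have [[n ->]|/iphi -> //] := pselect (finite_ordinal y).
  by have [m -> _] := fphi n; exact/ltW/infinite_ordinal_gt.
have [[k ak]|na] := pselect (finite_ordinal a); last first.
  right; exists a => // y /andP[ay yx]; rewrite /= iphi; first by apply: H; rewrite ay.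
  move=> [n yn]; apply: na; apply: (@finite_ordinal_initial n).
  by rewrite -yn ltW.
right; exists (fin_ordinal k.+1); first exact: infinite_ordinal_gt.
move=> y /andP[ky yx]; apply: H.
have [[n yn]|ny] := pselect (finite_ordinal y); last first.
  by rewrite /= iphi// yx ak infinite_ordinal_gt.
have [m mE nm] := fphi n; rewrite yn mE ak fin_ordinal_lt.
rewrite ltW ?infinite_ordinal_gt// andbT.
by move: ky; rewrite yn fin_ordinal_lt => kn; rewrite -ltnS (leq_trans kn).
Qed.

Lemma continuous_shift : continuous shift.
Proof.
apply: continuous_near_shift shift_infinite => n.
by exists n.+1; [exact: shift_fin|rewrite leqW// leqW].
Qed.

Lemma continuous_unshift : continuous unshift.
Proof.
apply: continuous_near_shift unshift_infinite => -[|n].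
  by exists 0%N => //; exact: unshift0.
by exists n; [exact: unshift_fin|].
Qed.

Lemma unshift_ge a : exists b, forall x, (b < x)%O -> (a < unshift x)%O.
Proof.
have [c cP] := finite_ordinal_bound; exists (Order.max a c) => x.
rewrite gt_max => /andP[ax cx]; rewrite unshift_infinite// => -[n xn].
by have := lt_trans (cP n) cx; rewrite xn ltxx.
Qed.

Section projections.
Variables (R : realType) (s : scalars).
Local Notation K := (scalar_field R s).
Local Notation C := (C_omega1S R s).
Local Notation C0 := (C0_omega1 R s).

Section club_projection.
Variables (D : set omega1) (cD : club D).

Fact club_complement_subproof (f : C0) :
  (fun x => f x - f (club_next cD x)) \in C0_omega1_pred (R := R) (s := s).
Proof.
apply/asboolP; split.
  apply: continuous_funB; first exact: C0_omega1_continuous.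
  move=> x; apply: continuous_comp; first exact: continuous_club_next.
  exact: C0_omega1_continuous.
have [a fa] := C0_omega1_vanish f; exists a => b ab.
by rewrite !fa ?subrr// (le_trans ab)// club_next_ge.
Qed.

Fact club_projection_subproof :
  (fun f : C0 => C0Omega1 (club_complement_subproof f) : C0)
    \in bounded_operator_pred (X := C0) (Y := C0).
Proof.
apply/asboolP; split.
  move=> a f g; apply/val_inj/funext => x.
  change ((a * f x + g x) - (a * f (club_next cD x) + g (club_next cD x)) =
    a * (f x - f (club_next cD x)) + (g x - g (club_next cD x))).
  by rewrite mulrBr opprD addrACA.
exists 2 => f; apply: C0_norm_le => [|x]; first by rewrite mulr_ge0.
by rewrite mulr_natl mulr2n (le_trans (ler_normB _ _))// lerD ?C0_le_norm.
Qed.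

Definition club_projection : bounded_operator C0 C0 :=
  BoundedOperator club_projection_subproof.

Lemma club_projection_idem : projection club_projection.
Proof.
apply: operatorP => f; apply/val_inj/funext => x.
change (f x - f (club_next cD x) -
  (f (club_next cD x) - f (club_next cD (club_next cD x))) =
  f x - f (club_next cD x)).
rewrite [club_next cD (club_next cD x)]club_next_id ?subrr ?subr0//.
exact: club_next_in.
Qed.

Lemma club_projection_norm : `|club_projection| <= 2.
Proof.
apply: operator_norm_le => // f; apply: C0_norm_le => [|x]; first by rewrite mulr_ge0.
by rewrite mulr_natl mulr2n (le_trans (ler_normB _ _))// lerD ?C0_le_norm.
Qed.

Lemma club_projection_vanish (T : bounded_operator C0 C0) :
  (forall x f, D x -> T f x = 0) -> club_projection \oB T = T.
Proof.
move=> TD; apply: operatorP => f; apply/val_inj/funext => x.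
by rewrite /= (TD _ f (club_next_in cD x)) subr0.
Qed.

End club_projection.

(** * An isomorphism of C[0, omega_1] onto C_0[0, omega_1) *)

Fact shift_to_C_subproof (g : C0) :
  (fun x : omega1S => if x is Some y then g (shift y) + g omega1_0 else g omega1_0)
    \in C_omega1S_pred (R := R) (s := s).
Proof.
have [a ga] := C0_omega1_vanish g.
apply/asboolP; apply: (@continuous_omega1S _ _ _ a).
  apply: continuous_funD; last exact: continuous_fun_cst.
  move=> x; apply: continuous_comp; first exact: continuous_shift.
  exact: C0_omega1_continuous.
move=> y ay; rewrite ga ?add0r// (le_trans (ltW ay))//.
by rewrite /shift; case: ifP => // _; exact/ltW/lt_omega1_succ.
Qed.

Fact shift_operator_subproof :
  (fun g : C0 => COmega1S (shift_to_C_subproof g) : C)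
    \in bounded_operator_pred (X := C0) (Y := C).
Proof.
apply/asboolP; split.
  move=> a f g; apply/val_inj/funext => -[x|//].
  change ((a * f (shift x) + g (shift x)) + (a * f omega1_0 + g omega1_0) =
    a * (f (shift x) + f omega1_0) + (g (shift x) + g omega1_0)).
  by rewrite mulrDr addrACA.
exists 2 => f; rewrite mulr_natl mulr2n; apply: C_norm_le => [|[x|]] /=.
- by rewrite addr_ge0.
- by rewrite (le_trans (ler_normD _ _))// lerD ?C0_le_norm.
- by rewrite (le_trans (C0_le_norm _ _))// lerDl.
Qed.

(** The inverse of [unshift_operator]: g(0) becomes the value at omega_1 and is added back at all
    other points. *)
Definition shift_operator : bounded_operator C0 C :=
  BoundedOperator shift_operator_subproof.

Fact unshift_to_C0_subproof (f : C) :
  (fun x => f (Some (unshift x)) - f omega1_pt) \in C0_omega1_pred (R := R) (s := s).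
Proof.
apply/asboolP; split.
  apply: continuous_funB; last exact: continuous_fun_cst.
  move=> x; apply: (@continuous_comp _ _ _ unshift (fun y => f (Some y))).
    exact: continuous_unshift.
  exact: (continuous_Some (@C_omega1S_continuous _ _ f)).
have [a fa] := eventually_cst (@C_omega1S_continuous _ _ f omega1_pt).
have [b bP] := unshift_ge a; have [c bc] := omega1_gt_ex b.
by exists c => x cx; rewrite fa ?subrr//; apply: bP; exact: lt_le_trans bc cx.
Qed.

(* f |-> f - f(omega_1), moved up by the shift to make room for the scalar
   f(omega_1) at the point 0; the correction term sets that value. *)
Definition unshift_to_C0 (f : C) : C0 := C0Omega1 (unshift_to_C0_subproof f) +
  (f omega1_pt - (f (Some omega1_0) - f omega1_pt)) *: cut1 R s omega1_0.

Lemma unshift_to_C0E f x : unshift_to_C0 f x =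
  if (x <= omega1_0)%O then f omega1_pt else f (Some (unshift x)) - f omega1_pt.
Proof.
rewrite C0DE C0ZE /=; case: ifPn => x0; last by rewrite mulr0 addr0.
have -> : x = omega1_0 by apply/le_anti; rewrite x0 omega1_0_le.
by rewrite unshift0 mulr1 addrCA subrr addr0.
Qed.

Fact unshift_operator_subproof :
  unshift_to_C0 \in bounded_operator_pred (X := C) (Y := C0).
Proof.
apply/asboolP; split.
  move=> a f g; apply/val_inj/funext => x.
  change (unshift_to_C0 (a *: f + g) x = a * unshift_to_C0 f x + unshift_to_C0 g x).
  rewrite !unshift_to_C0E; case: ifP => // _.
  set y := Some (unshift x).
  change ((a * f y + g y) - (a * f omega1_pt + g omega1_pt) =
    a * (f y - f omega1_pt) + (g y - g omega1_pt)).
  by rewrite mulrBr opprD addrACA.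
exists 2 => f; rewrite mulr_natl mulr2n; apply: C0_norm_le => [|x].
  by rewrite addr_ge0.
rewrite unshift_to_C0E; case: ifP => _.
  by rewrite (le_trans (C_le_norm _ _))// lerDl.
by rewrite (le_trans (ler_normB _ _))// lerD ?C_le_norm.
Qed.

Definition unshift_operator : bounded_operator C C0 :=
  BoundedOperator unshift_operator_subproof.

Lemma shift_operator_inverse : operator_inverse unshift_operator shift_operator.
Proof.
split=> f; apply/val_inj/funext.
  case=> [x|]; last first.
    change (unshift_to_C0 f omega1_0 = f omega1_pt).
    by rewrite unshift_to_C0E lexx.
  change (unshift_to_C0 f (shift x) + unshift_to_C0 f omega1_0 = f (Some x)).
  by rewrite !unshift_to_C0E lexx leNgt shift_gt0 /= shiftK subrK.
move=> x; change (unshift_to_C0 (shift_operator f) x = f x).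
rewrite unshift_to_C0E; case: ifPn => [x0|].
  by have -> : x = omega1_0 by apply/le_anti; rewrite x0 omega1_0_le.
by rewrite -ltNge => x0; rewrite /= unshiftK// addrK.
Qed.

(** * The column of omega_1 in the matrix of a conjugated projection *)

(* k is the entry at omega_1 of the row of the matrix representing phi. *)
Definition top_coefficient (phi : bounded_operator C K) (k : K) :=
  exists2 g, functional_coefficients phi g & g omega1_pt = k.

Lemma top_coefficient_evaluation x :
  top_coefficient (point_evaluation R s x) (x == omega1_pt)%:R.
Proof.
exists (fun y => (x == y)%:R) => //; split.
  exists 1 => A; rewrite /summability.partial_sum.
  have [xA|xA] := boolP (x \in A).
    rewrite (bigD1 [` xA]%fset)//= eqxx normr1 big1 ?addr0// => i.
    by rewrite -val_eqE /= eq_sym => /negPf ->; rewrite normr0.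
  rewrite big1// => i _; case: eqP => [xi|_]; last by rewrite normr0.
  by move: xA; rewrite xi (valP i).
(* The coefficients are a Kronecker delta, so the partial sum is exact as soon as A contains x. *)
apply: cvg_near_cst; first exact: summability.totally_filter.
exists [fset x]%fset => //= A /fsubsetP xA.
have {}xA : x \in A by apply: xA; rewrite inE.
apply: operatorP => f; rewrite /summability.partial_sum operator_sumE.
rewrite (bigD1 [` xA]%fset)//= eqxx scale1r big1 ?addr0// => i.
by rewrite -val_eqE /= eq_sym => /negPf ->; rewrite scale0r.
Qed.

Lemma top_coefficient_linear a phi psi k l :
  top_coefficient phi k -> top_coefficient psi l ->
  top_coefficient (a *: phi + psi) (a * k + l).
Proof.
move=> [g [[M gM] gc] <-] [h [[N hN] hc] <-].
exists (fun x => a * g x + h x) => //; split.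
  exists (`|a| * M + N) => A.
  apply: (@le_trans _ _ (`|a| * summability.partial_sum (fun x => `|g x|) A +
    summability.partial_sum (fun x => `|h x|) A)).
    rewrite /summability.partial_sum mulr_sumr -big_split /= ler_sum// => i _.
    by rewrite (le_trans (ler_normD _ _))// normrM.
  by rewrite lerD// ler_wpM2l.
have -> : summability.partial_sum
    (fun x => (a * g x + h x) *: point_evaluation R s x) =
  (fun A => a *: summability.partial_sum (fun x => g x *: point_evaluation R s x) A +
    summability.partial_sum (fun x => h x *: point_evaluation R s x) A).
  apply/funext => A; rewrite /summability.partial_sum scaler_sumr -big_split /=.
  by apply: eq_bigr => i _; rewrite scalerDl scalerA.
have FF := @summability.totally_filter omega1S.
by apply: cvgD => //; apply: cvgZl_tmp.
Qed.

Lemma top_coefficient_ext (phi psi : bounded_operator C K) k : (forall f, phi f = psi f) ->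
  top_coefficient phi k -> top_coefficient psi k.
Proof. by move=> /operatorP ->. Qed.

(** With U = [unshift_operator], (U f)(0) is f(omega_1), while (U f)(x) for x > 0 contains -
    f(omega_1). *)
Definition unshift_top (x : omega1) : K := if (x <= omega1_0)%O then 1 else -1.

Lemma top_coefficient_unshift x :
  top_coefficient (C0_evaluation R s x \oB unshift_operator) (unshift_top x).
Proof.
rewrite /unshift_top; case: ifPn => x0.
  have -> : C0_evaluation R s x \oB unshift_operator = point_evaluation R s omega1_pt.
    apply: operatorP => f; change (unshift_to_C0 f x = f omega1_pt).
    by rewrite unshift_to_C0E x0.
  exact: (top_coefficient_evaluation omega1_pt).
have -> : C0_evaluation R s x \oB unshift_operator =
    (-1) *: point_evaluation R s omega1_pt + point_evaluation R s (Some (unshift x)).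
  apply: operatorP => f.
  change (unshift_to_C0 f x = (-1) * f omega1_pt + f (Some (unshift x))).
  by rewrite unshift_to_C0E (negPf x0) mulN1r addrC.
have := top_coefficient_linear (-1) (top_coefficient_evaluation omega1_pt)
  (top_coefficient_evaluation (Some (unshift x))).
by rewrite mulr1 addr0.
Qed.

(** All rows of the matrix have the same entry k at omega_1, so that column is constant. *)
Lemma club_projection_Loy_Willis D (cD : club D) :
  Loy_Willis_ideal (club_projection cD).
Proof.
exists unshift_operator, shift_operator; split; first exact: shift_operator_inverse.
pose e x := C0_evaluation R s x \oB unshift_operator.
have diff x : top_coefficient (e x - e (club_next cD x))
    (unshift_top x - unshift_top (club_next cD x)).
  have := top_coefficient_linear (-1) (top_coefficient_unshift (club_next cD x))
    (top_coefficient_unshift x).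
  rewrite scaleN1r mulN1r (addrC (- unshift_top _)).
  by rewrite (addrC (- (C0_evaluation R s _ \oB _))).
pose k := unshift_top omega1_0 - unshift_top (club_next cD omega1_0).
have /choice[m mP] (b : omega1S) : exists g : omega1S -> K,
    functional_coefficients (point_evaluation R s b \oB
      (shift_operator \oB club_projection cD \oB unshift_operator)) g /\
    g omega1_pt = k.
  suff [g] : top_coefficient (point_evaluation R s b \oB
      (shift_operator \oB club_projection cD \oB unshift_operator)) k by exists g.
  case: b => [x|].
    (* Row x is row omega_1 plus the difference at [shift x]. Both [shift x] and its successor in D
       are positive, so their coefficients -1 cancel. *)
    have := top_coefficient_linear 1 (diff (shift x)) (diff omega1_0).
    rewrite /unshift_top -[(shift x <= _)%O]negbK -ltNge shift_gt0 /=.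
    rewrite leNgt (lt_le_trans (shift_gt0 x) (club_next_ge _ _)) /= subrr mulr0 add0r.
    by apply: top_coefficient_ext => f; rewrite scale1r.
  by have := diff omega1_0; apply: top_coefficient_ext => f.
exists m => [b|]; first exact: (mP b).1.
rewrite (_ : (fun b => m b omega1_pt) = cst k); last first.
  by apply/funext => b; exact: (mP b).2.
exact: continuous_fun_cst.
Qed.

End projections.

Theorem corollary1p7 (R : realType) (s : scalars) :
  exists (Gamma : Type) (le : Gamma -> Gamma -> Prop)
    (Q : Gamma -> bounded_operator (C0_omega1 R s) (C0_omega1 R s)),
  [/\ directed le,
      (forall D, [/\ Loy_Willis_ideal (Q D), projection (Q D) & `|Q D| <= 2]),
      (forall T, Loy_Willis_ideal T ->
         exists D0, forall D, le D0 D -> Q D \oB T = T) &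
      bounded_left_approximate_identity (@Loy_Willis_ideal R s) le Q].
Proof.
pose Gamma := {D : set omega1 | club D}.
pose le (D E : Gamma) := sval E `<=` sval D.
pose Q (D : Gamma) := club_projection R s (svalP D).
have dir : directed le.
  split => //.
  - exact: inhabits (exist _ _ clubT).
  - by move=> D x.
  - by move=> D E F DE EF x /EF /DE.
  - move=> D E; exists (exist _ _ (clubI (svalP D) (svalP E))).
      exact: subIsetl.
    exact: subIsetr.
have ev T : Loy_Willis_ideal T -> exists D0, forall D, le D0 D -> Q D \oB T = T.
  move=> /Loy_Willis_ideal_vanish[D cD TD]; exists (exist _ D cD) => E DE.
  by apply: club_projection_vanish => x f /DE; exact: TD.
exists Gamma, le, Q; split => //.
  move=> D; split; [exact: club_projection_Loy_Willis|exact: club_projection_idem|].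
  exact: club_projection_norm.
split => //; first by move=> D; exact: club_projection_Loy_Willis.
  by exists 2 => D; exact: club_projection_norm.
(* The net is eventually equal to T, hence in every neighbourhood of T. *)
move=> T /ev[D0 D0P] A nA; exists D0 => // D /D0P QT; rewrite /= QT.
exact: nbhs_singleton nA.
Qed.
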